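(* $$\sum_{n\ge0}\Bigl(\sum_{\sigma\in\mathfrak S_{n+1}}u^{2{\rm M}(\sigma)}v^{n-2{\rm M}(\sigma)}\alpha^{{\rm LRmin}(\sigma)-1}\beta^{{\rm RLmin}(\sigma)-1}\Bigr)\frac{t^n}{n!}=\left(\frac{\sqrt{v^2-u^2}}{\sqrt{v^2-u^2}\cosh\bigl(t\sqrt{v^2-u^2}\bigr)-v\sinh\bigl(t\sqrt{v^2-u^2}\bigr)}\right)^{\alpha+\beta}.$$
   Context: For $\sigma=\sigma_1\cdots\sigma_m\in\mathfrak S_m$: ${\rm M}(\sigma)$ is the number of $i$ with $1<i<m$ and $\sigma_{i-1}<\sigma_i>\sigma_{i+1}$; ${\rm LRmin}(\sigma)$ is the number of $i$ with $\sigma_j>\sigma_i$ for all $j<i$; ${\rm RLmin}(\sigma)$ is the number of $i$ with $\sigma_j>\sigma_i$ for all $j>i$. Identity of formal power series in $t$; powers of series with constant term $1$ are $G^c=\exp(c\log G)$. *)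

(* Defs.v *)
From mathcomp Require Import all_boot all_order all_algebra all_fingroup.
Set Implicit Arguments. Unset Strict Implicit. Unset Printing Implicit Defensive.
Import GRing.Theory.
Local Open Scope ring_scope.

(* A permutation s of 'I_m is read as the word s(0) s(1) ... s(m-1)
   (values in 0..m-1; only relative order matters for the statistics). *)
Definition pword m (s : 'S_m) : seq nat := [seq (val (s i)) | i <- enum 'I_m].

Definition peaks (w : seq nat) : nat :=
  count (fun i => (nth 0 w i.-1 < nth 0 w i)%N && (nth 0 w i.+1 < nth 0 w i)%N)
        (iota 1 (size w - 2)).

Definition LRmin (w : seq nat) : nat :=
  count (fun i => all (fun j => (nth 0 w i < nth 0 w j)%N) (iota 0 i))
        (iota 0 (size w)).

Definition RLmin (w : seq nat) : nat :=
  count (fun i => all (fun j => (nth 0 w i < nth 0 w j)%N)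
                      (iota i.+1 (size w - i.+1)))
        (iota 0 (size w)).

Definition fps (R : Type) := nat -> R.

Section FPS.
Variable R : fieldType.

Definition fps_one : fps R := fun n => (n == 0%N)%:R.
Definition fps_add (f g : fps R) : fps R := fun n => f n + g n.
Definition fps_sub (f g : fps R) : fps R := fun n => f n - g n.
Definition fps_scale (c : R) (f : fps R) : fps R := fun n => c * f n.
Definition fps_mul (f g : fps R) : fps R :=
  fun n => \sum_(i < n.+1) f i * g (n - i)%N.
Definition fps_pow (f : fps R) (k : nat) : fps R := iter k (fps_mul f) fps_one.

(* Multiplicative inverse of a series with invertible constant term:
   f = f0 (1 + h) with h(0) = 0, and (1+h)^{-1} = sum_k (-h)^k
   (only k <= n contributes to the coefficient of t^n). *)
Definition fps_inv (f : fps R) : fps R :=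
  let h := fps_sub (fps_scale (f 0%N)^-1 f) fps_one in
  fun n => (f 0%N)^-1 * \sum_(k < n.+1) fps_pow (fps_scale (-1) h) k n.

(* exp(h) = sum_k h^k / k!  for h with zero constant term. *)
Definition fps_exp (h : fps R) : fps R :=
  fun n => \sum_(k < n.+1) fps_pow h k n / (k`!)%:R.

(* log(g) = sum_{k>=1} (-1)^(k+1) (g-1)^k / k  for g with constant term 1. *)
Definition fps_log (g : fps R) : fps R :=
  fun n => \sum_(1 <= k < n.+1) (-1) ^+ k.+1 / k%:R * fps_pow (fps_sub g fps_one) k n.

Definition fps_powc (g : fps R) (c : R) : fps R := fps_exp (fps_scale c (fps_log g)).

Definition fps_cosh (s : R) : fps R := fun n => if odd n then 0 else s ^+ n / (n`!)%:R.
Definition fps_sinh (s : R) : fps R := fun n => if odd n then s ^+ n / (n`!)%:R else 0.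

Definition rhs_base (v s : R) : fps R :=
  fps_scale s (fps_inv (fps_sub (fps_scale s (fps_cosh s)) (fps_scale v (fps_sinh s)))).

End FPS.

(* Main.v *)
(* Every permutation of size m + 1 arises uniquely by inserting a maximum into one
   of size m.  At the left (right) end this adds one left-to-right (right-to-left)
   minimum and no peak; among the m - 1 inner gaps, the 2 M next to a peak leave M
   unchanged and the others increase it by 1.  On monomials this is the operator
   (alpha + beta) v + D, with D the derivation u -> u v, v -> u^2.  The logarithmic
   derivative Y of the base F of the right-hand side satisfies Y' = Y^2 - s^2, so
   with W = Y' one has W' = 2 Y W: differentiating F^(alpha + beta) repeatedly runs
   the same recursion, with (W, Y) in place of (u^2, v), and the constant terms of
   W and Y are u^2 and v. *)
Require Import Defs.
From HB Require Import structures.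
From mathcomp Require Import all_boot all_order all_algebra all_fingroup.
From mathcomp Require Import boolp ring zify.
Import GRing.Theory.
Local Open Scope ring_scope.

(** * Formal power series *)

Section SeriesRing.
Variable R : fieldType.
Implicit Types f g h : fps R.

(** The coefficients of a product below degree [N] depend only on the truncations of the factors, so
    the ring laws and the Leibniz rule can be read off from polynomials. *)
Let trunc (N : nat) f : {poly R} := \poly_(i < N) f i.

Let coef_truncM N f g k : (k < N)%N ->
  fps_mul f g k = (trunc N f * trunc N g)`_k.
Proof.
move=> kN; rewrite coefM; apply: eq_bigr => i _.
have ik : (i <= k)%N by rewrite -ltnS ltn_ord.
by rewrite !coef_poly (leq_ltn_trans ik kN) (leq_ltn_trans (leq_subr i k) kN).
Qed.

Lemma fps_mulC : commutative (@fps_mul R).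
Proof.
by move=> f g; apply/funext => n; rewrite !(coef_truncM n.+1)// mulrC.
Qed.

Lemma fps_mulA : associative (@fps_mul R).
Proof.
move=> f g h; apply/funext => n.
transitivity (trunc n.+1 f * (trunc n.+1 g * trunc n.+1 h))`_n.
  rewrite coefM; apply: eq_bigr => i _.
  by rewrite coef_poly ltn_ord (coef_truncM n.+1) // ltnS leq_subr.
rewrite mulrA coefM; apply: eq_bigr => i _.
by rewrite (coef_truncM n.+1) ?ltn_ord // coef_poly ltnS leq_subr.
Qed.

Lemma fps_mul1 : left_id (@fps_one R) (@fps_mul R).
Proof.
move=> f; apply/funext => n; rewrite /fps_mul big_ord_recl /fps_one /= mul1r subn0.
by rewrite big1 ?addr0 // => i _; rewrite mul0r.
Qed.

Lemma fps_mulDl : left_distributive (@fps_mul R) (@fps_add R).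
Proof.
move=> f g h; apply/funext => n; rewrite /fps_mul /fps_add -big_split.
by apply: eq_bigr => i _; rewrite mulrDl.
Qed.

Lemma fps_addA : associative (@fps_add R).
Proof. by move=> f g h; apply/funext => n; apply: addrA. Qed.

Lemma fps_addC : commutative (@fps_add R).
Proof. by move=> f g; apply/funext => n; apply: addrC. Qed.

Lemma fps_add0 : left_id (fun=> 0) (@fps_add R).
Proof. by move=> f; apply/funext => n; apply: add0r. Qed.

Lemma fps_addN : left_inverse (fun=> 0) (fun f n => - f n) (@fps_add R).
Proof. by move=> f; apply/funext => n; apply: addNr. Qed.

Lemma fps_one_neq0 : @fps_one R <> fun=> 0.
Proof. by move/(congr1 (@^~ 0%N))/eqP; rewrite oner_eq0. Qed.

HB.instance Definition _ := gen_eqMixin (fps R).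
HB.instance Definition _ := gen_choiceMixin (fps R).
HB.instance Definition _ :=
  GRing.isZmodule.Build (fps R) fps_addA fps_addC fps_add0 fps_addN.
HB.instance Definition _ := GRing.Zmodule_isComNzRing.Build (fps R)
  fps_mulA fps_mulC fps_mul1 fps_mulDl (introN eqP fps_one_neq0).

(** Naming the evaluation lets it carry a morphism structure: additive for every [n], and
    multiplicative for [n = 0]. *)
Definition coef (n : nat) f : R := f n.

Lemma coef_is_zmod_morphism n : zmod_morphism (coef n).
Proof. by []. Qed.
HB.instance Definition _ n :=
  GRing.isZmodMorphism.Build (fps R) R (coef n) (coef_is_zmod_morphism n).

Lemma coefE n f : coef n f = f n. Proof. by []. Qed.

Lemma coefB n f g : coef n (f - g) = coef n f - coef n g. Proof. by []. Qed.

Lemma coefN n f : coef n (- f) = - coef n f. Proof. by []. Qed.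

Lemma coef_sum n I r (P : pred I) (g : I -> fps R) :
  coef n (\sum_(i <- r | P i) g i) = \sum_(i <- r | P i) coef n (g i).
Proof. exact: raddf_sum. Qed.

Lemma coefM f g n : coef n (f * g) = \sum_(i < n.+1) coef i f * coef (n - i) g.
Proof. by []. Qed.

Lemma coef0_is_monoid_morphism : monoid_morphism (coef 0).
Proof.
by split=> // f g; rewrite coefM big_ord1.
Qed.
HB.instance Definition _ := GRing.isMonoidMorphism.Build (fps R) R (coef 0)
  coef0_is_monoid_morphism.

Definition fps_const (c : R) : fps R := fps_scale c 1.

Lemma coef_const c n : coef n (fps_const c) = c *+ (n == 0%N).
Proof. by rewrite /coef /fps_const /fps_scale mulr_natr. Qed.

Lemma coef_constM c f n : coef n (fps_const c * f) = c * coef n f.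
Proof.
rewrite coefM big_ord_recl subn0 coef_const mulr1n big1 ?addr0 // => i _.
by rewrite coef_const mul0r.
Qed.

Lemma fps_scaleE c f : fps_scale c f = fps_const c * f.
Proof. by apply/funext => n; rewrite -!coefE coef_constM. Qed.

Lemma fps_const_is_zmod_morphism : zmod_morphism fps_const.
Proof.
move=> a b; apply/funext => n.
by rewrite -!coefE raddfB /= !coef_const mulrnBl.
Qed.

Lemma fps_const_is_monoid_morphism : monoid_morphism fps_const.
Proof.
split; first by apply/funext => n; rewrite -!coefE coef_const.
by move=> a b; apply/funext => n; rewrite -!coefE coef_constM !coef_const mulrnAr.
Qed.
HB.instance Definition _ :=
  GRing.isZmodMorphism.Build R (fps R) fps_const fps_const_is_zmod_morphism.
HB.instance Definition _ :=
  GRing.isMonoidMorphism.Build R (fps R) fps_const fps_const_is_monoid_morphism.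

Lemma fps_powE f k : fps_pow f k = f ^+ k.
Proof. by elim: k => // k IH; rewrite /fps_pow iterS -/(fps_pow f k) IH exprS. Qed.

(** Each of the [k] factors has order at least 1. This is what makes the infinite sums below finite
    in each degree. *)
Lemma coef_exp_small f k n : f 0%N = 0 -> (n < k)%N -> coef n (f ^+ k) = 0.
Proof.
move=> f0; elim: k n => // k IH n nk; rewrite exprS coefM big1 // => i _.
case: (posnP i) => [i0|i_gt0]; first by rewrite i0 coefE f0 mul0r.
by rewrite IH ?mulr0 //; have := ltn_ord i; lia.
Qed.

Lemma coefM_eq f g1 g2 n :
  (forall i, (i <= n)%N -> coef i g1 = coef i g2) ->
  coef n (f * g1) = coef n (f * g2).
Proof. by move=> eqg; rewrite !coefM; apply: eq_bigr => i _; rewrite eqg ?leq_subr. Qed.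

(** * Derivation *)

Definition fps_deriv f : fps R := fun n => f n.+1 *+ n.+1.

Lemma coef_deriv f n : coef n (fps_deriv f) = coef n.+1 f *+ n.+1.
Proof. by []. Qed.

Lemma fps_deriv_is_zmod_morphism : zmod_morphism fps_deriv.
Proof.
by move=> f g; apply/funext => n; rewrite -!coefE raddfB !coef_deriv raddfB mulrnBl.
Qed.
HB.instance Definition _ :=
  GRing.isZmodMorphism.Build (fps R) (fps R) fps_deriv fps_deriv_is_zmod_morphism.

Let coef_trunc_deriv N f k : (k.+1 < N)%N -> fps_deriv f k = (trunc N f)^`()`_k.
Proof. by move=> kN; rewrite poly.coef_deriv coef_poly kN. Qed.

Lemma fps_derivM f g : fps_deriv (f * g) = fps_deriv f * g + f * fps_deriv g.
Proof.
apply/funext => n; rewrite -!coefE raddfD /= coef_deriv.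
have -> : coef n.+1 (f * g) = (trunc n.+2 f * trunc n.+2 g)`_n.+1 by exact: coef_truncM.
rewrite -poly.coef_deriv derivM coefD; congr (_ + _).
  rewrite poly.coefM; apply: eq_bigr => i _.
  have lt_i : (i.+1 < n.+2)%N by rewrite !ltnS -ltnS ltn_ord.
  rewrite -(coef_trunc_deriv n.+2 f i lt_i).
  by rewrite coef_poly ltnS (leq_trans (leq_subr _ _) (leqnSn _)).
rewrite poly.coefM; apply: eq_bigr => i _.
rewrite -(coef_trunc_deriv n.+2 g) ?ltnS ?leq_subr //.
by rewrite coef_poly (leq_trans (ltn_ord i)).
Qed.

Lemma fps_deriv_const c : fps_deriv (fps_const c) = 0.
Proof. by apply/funext => n; rewrite -!coefE coef_deriv coef_const mul0rn. Qed.

Lemma fps_derivXn f k : fps_deriv (f ^+ k) = fps_deriv f * f ^+ k.-1 *+ k.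
Proof.
elim: k => [|k IH]; first by rewrite expr0 -(rmorph1 fps_const) fps_deriv_const.
rewrite exprS fps_derivM IH /= mulrnAr mulrCA mulrS.
by case: k {IH} => [|k]; rewrite ?mulr0n // exprS.
Qed.

(** Taylor's formula at 0: it turns the claim on exponential generating functions into one on
    iterated derivatives. *)
Lemma coef0_iter_deriv n f : coef 0 (iter n fps_deriv f) = coef n f *+ n`!.
Proof.
elim: n f => // n IH f; rewrite iterSr IH coef_deriv factS.
by rewrite -mulrnA.
Qed.

(** * Inverse, exponential and logarithm *)

Lemma fps_mulV f : f 0%N != 0 -> f * fps_inv f = 1.
Proof.
move=> f0; set c := f 0%N in f0 *.
pose h : fps R := fps_const c^-1 * f - 1.
have h0 : h 0%N = 0.
  by rewrite -coefE raddfB /= coef_constM coefE -/c mulVf // rmorph1 subrr.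
have fE : f = fps_const c * (1 - - h).
  by rewrite opprK addrC subrK mulrA -rmorphM divff // rmorph1 mul1r.
pose S n := fps_const c^-1 * \sum_(k < n) (- h) ^+ k.
(* The truncation in [fps_inv] moves with the degree; one fixed partial sum serves all degrees up to
   [n], since the extra powers vanish there. *)
have invE n i : (i <= n)%N -> coef i (fps_inv f) = coef i (S n.+1).
  move=> le_in; rewrite /S coef_constM coefE /fps_inv -/c; congr (_ * _).
  rewrite raddf_sum /= -(subnKC le_in) -addSn big_split_ord /= [X in _ + X]big1 ?addr0.
    apply: eq_bigr => k _; rewrite -coefE fps_powE; congr (coef i (_ ^+ k)).
    by rewrite fps_scaleE fps_scaleE rmorphN1 mulN1r.
  move=> k _; apply: coef_exp_small; last by rewrite addSn ltnS leq_addr.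
  by rewrite -coefE raddfN /= coefE h0 oppr0.
apply/funext => n; rewrite -!coefE (coefM_eq _ _ _ _ (invE n)).

(* The geometric sum telescopes to 1 - (-h)^(n+1), whose last term does not reach degree [n]. *)
rewrite {1}fE mulrACA -rmorphM divff // rmorph1 mul1r -opprB mulNr -subrX1 opprB.
by rewrite raddfB /= (coef_exp_small _ n.+1) ?subr0 // -coefE raddfN /= coefE h0 oppr0.
Qed.

(** With a bound independent of [i], the exponential becomes a finite sum of ring elements, which
    can be differentiated term by term. *)
Lemma coef_fps_exp h n i : h 0%N = 0 -> (i <= n)%N ->
  coef i (fps_exp h) = coef i (\sum_(k < n.+1) fps_const (k`!%:R)^-1 * h ^+ k).
Proof.
move=> h0 le_in.
rewrite raddf_sum /= -(subnKC le_in) -addSn big_split_ord /= [X in _ + X]big1 ?addr0.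
  by apply: eq_bigr => k _; rewrite coef_constM fps_powE mulrC.
move=> k _; rewrite coef_constM coef_exp_small ?mulr0 //.
by rewrite addSn ltnS leq_addr.
Qed.

Lemma coef_fps_log f n i : f 0%N = 1 -> (i <= n)%N ->
  coef i (fps_log f) =
  coef i (\sum_(1 <= k < n.+1) fps_const ((-1) ^+ k.+1 / k%:R) * (f - 1) ^+ k).
Proof.
move=> f0 le_in; rewrite raddf_sum /= (big_cat_nat _ _ (n := i.+1)) //=.
rewrite [X in _ + X]big_nat_cond [X in _ + X]big1 ?addr0.
  by apply: eq_bigr => k _; rewrite coef_constM fps_powE.
move=> k /andP[/andP[lt_ik _] _]; rewrite coef_constM coef_exp_small ?mulr0 //.
by rewrite -coefE raddfB /= coefE f0 subrr.
Qed.

Hypothesis char0 : [pchar R] =i pred0.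

Let natS_neq0 n : n.+1%:R != 0 :> R.
Proof. by move/pcharf0P: char0 => ->. Qed.

Lemma fps_deriv_exp h : h 0%N = 0 ->
  fps_deriv (fps_exp h) = fps_deriv h * fps_exp h.
Proof.
move=> h0; apply/funext => n; rewrite -!coefE.
rewrite (coefM_eq _ _ _ _ (fun i => coef_fps_exp h n i h0)).
(* Differentiation lowers degrees by one, so the left side is cut one power later; its constant term
   drops out and the two sums align. *)
rewrite coef_deriv (coef_fps_exp h n.+1 n.+1) // -coef_deriv; congr (coef n _).
rewrite raddf_sum big_ord_recl /= expr0 mulr1 fps_deriv_const add0r mulr_sumr.
apply: eq_bigr => k _; rewrite /bump /= add1n fps_derivM fps_deriv_const mul0r add0r.
rewrite fps_derivXn /= mulrnAr -mulrnAl mulrCA -raddfMn /=; congr (_ * (fps_const _ * _)).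
by rewrite factS natrM invfM -[_ *+ _]mulr_natr mulrAC mulVf ?mul1r//.
Qed.

(** Termwise, the derivative of the logarithm is x' times the geometric sum of the powers of -x, and
    multiplying by [f] = 1 + x telescopes it. *)
Lemma fps_log_deriv f : f 0%N = 1 -> fps_deriv (fps_log f) * f = fps_deriv f.
Proof.
move=> f0; pose x := f - 1.
have x0 : x 0%N = 0 by rewrite -coefE raddfB /= coefE f0 subrr.
have fE : f = 1 - (- x) by rewrite opprK addrC subrK.
pose L n := \sum_(k < n.+1) (- x) ^+ k.
have derivL n i : (i <= n)%N ->
    coef i (fps_deriv (fps_log f)) = coef i (fps_deriv x * L n).
  move=> le_in; rewrite coef_deriv (coef_fps_log f n.+1) // -coef_deriv.
  congr (coef i _); rewrite raddf_sum /= big_add1 /= big_mkord mulr_sumr.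
  apply: eq_bigr => k _; rewrite fps_derivM fps_deriv_const mul0r add0r.
  rewrite fps_derivXn /= -/x (exprNn x) mulrnAr -mulrnAl mulrCA -raddfMn /=; congr (_ * (_ * _)).
  rewrite -[_ / _ *+ _]mulr_natr divfK// !exprS !mulN1r opprK.
  by rewrite rmorphXn rmorphN1.
apply/funext => n; rewrite -!coefE mulrC (coefM_eq _ _ _ _ (derivL n)).
have fL : f * L n = 1 - (- x) ^+ n.+1 by rewrite {1}fE -opprB mulNr -subrX1 opprB.
rewrite mulrCA fL mulrBr mulr1 raddfB /=.
rewrite coefM big1 ?subr0 => [|i _]; last first.
  by rewrite coef_exp_small ?mulr0 ?ltnS ?leq_subr // -coefE raddfN /= coefE x0 oppr0.
by rewrite raddfB /= -(rmorph1 fps_const) fps_deriv_const subr0.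
Qed.

Lemma coef0_fps_log f : fps_log f 0%N = 0.
Proof. by rewrite /fps_log big_geq. Qed.

Lemma fps_deriv_powc f c : f 0%N = 1 ->
  fps_deriv (fps_powc f c) = fps_const c * fps_deriv (fps_log f) * fps_powc f c.
Proof.
move=> f0; rewrite /fps_powc fps_deriv_exp fps_scaleE.
  by rewrite fps_derivM fps_deriv_const mul0r add0r.
by rewrite -coefE coef_constM coefE coef0_fps_log mulr0.
Qed.

Lemma coef0_powc f c : fps_powc f c 0%N = 1.
Proof. by rewrite /fps_powc /fps_exp big_ord1 /fps_pow /= invr1 mulr1. Qed.

Lemma fps_deriv_cosh s : fps_deriv (fps_cosh s) = fps_const s * fps_sinh s.
Proof.
apply/funext => n; rewrite -!coefE coef_deriv coef_constM /coef /fps_cosh /fps_sinh /=.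
case: (odd n); rewrite /= ?mulr0 ?mul0rn //.
rewrite -[_ / _ *+ _]mulr_natr factS natrM invfM exprS -!mulrA; congr (_ * (_ * _)).
by rewrite mulrCA mulVf // mulr1.
Qed.

Lemma fps_deriv_sinh s : fps_deriv (fps_sinh s) = fps_const s * fps_cosh s.
Proof.
apply/funext => n; rewrite -!coefE coef_deriv coef_constM /coef /fps_cosh /fps_sinh /=.
case: (odd n); rewrite /= ?mulr0 ?mul0rn //.
rewrite -[_ / _ *+ _]mulr_natr factS natrM invfM exprS -!mulrA; congr (_ * (_ * _)).
by rewrite mulrCA mulVf // mulr1.
Qed.

End SeriesRing.

Arguments coef {R} n f.
Arguments fps_const {R} c.
Arguments fps_deriv {R} f.

(** * Inserting a maximum into a word *)

Definition insert (i a : nat) (w : seq nat) : seq nat := take i w ++ a :: drop i w.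

Lemma LRmin_rcons w x : LRmin (rcons w x) = (LRmin w + all (ltn x) w)%N.
Proof.
rewrite /LRmin size_rcons -addn1 iotaD count_cat add0n /= addn0; congr (_ + _)%N.
  apply: eq_in_count => i; rewrite mem_iota add0n => /= lt_iw.
  rewrite nth_rcons lt_iw; apply: eq_in_all => j.
  by rewrite mem_iota add0n => /= lt_ji; rewrite nth_rcons (ltn_trans lt_ji).
rewrite nth_rcons ltnn eqxx -[w in RHS](mkseq_nth 0%N) all_map; congr (nat_of_bool _).
apply: eq_in_all => j; rewrite mem_iota add0n => /= lt_jw.
by rewrite nth_rcons lt_jw.
Qed.

Lemma RLmin_cons x w : RLmin (x :: w) = (all (ltn x) w + RLmin w)%N.
Proof.
rewrite /RLmin /= subn1 /=; congr (nat_of_bool _ + _)%N.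
  rewrite -[w in RHS](mkseq_nth 0%N) all_map (iotaDl 1 0) all_map.
  by apply: eq_all.
rewrite (iotaDl 1 0) count_map; apply: eq_count => i /=.
rewrite !subSS (iotaDl 1 i.+1) all_map.
by apply: eq_all.
Qed.

(** Induction on the part after the gap, from its right end: a letter below [a] is as much a minimum
    with [a] before it as without. At the base, [a] is last and is a minimum only if nothing
    precedes it. *)
Lemma LRmin_insert a w i : all (gtn a) w -> (i <= size w)%N ->
  LRmin (insert i a w) = (LRmin w + (i == 0))%N.
Proof.
move=> w_lt le_iw; rewrite /insert.
have -> : (i == 0)%N = nilp (take i w) by rewrite /nilp size_takel.
move: w_lt; rewrite -{1 4}(cat_take_drop i w) all_cat => /andP[].
move: (take i w) (drop i w) => w1; elim/last_ind => [|w2 x IH] lt_w1.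
  rewrite cats1 LRmin_rcons cats0 => _; congr (_ + nat_of_bool _)%N.
  by case: w1 lt_w1 => //= y w1 /andP[ya _]; rewrite ltnNge ltnW.
rewrite all_rcons => /andP[/= xa lt_w2].
rewrite -rcons_cons -!rcons_cat !LRmin_rcons IH // addnAC; congr (_ + nat_of_bool _ + _)%N.
by rewrite !all_cat /= xa.
Qed.

Lemma RLmin_insert a w i : all (gtn a) w -> (i <= size w)%N ->
  RLmin (insert i a w) = (RLmin w + (i == size w))%N.
Proof.
move=> w_lt le_iw; rewrite /insert.
have -> : (i == size w)%N = nilp (drop i w) by rewrite /nilp size_drop subn_eq0 eqn_leq le_iw.
move: w_lt; rewrite -{1 4}(cat_take_drop i w) all_cat => /andP[].
move: (take i w) (drop i w) => w1 w2; elim: w1 => [|x w1 IH] /= + lt_w2.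
  rewrite RLmin_cons addnC => _; congr (_ + nat_of_bool _)%N.
  by case: w2 lt_w2 => //= y w1 /andP[ya _]; rewrite ltnNge ltnW.
move=> /andP[/= xa lt_w1].
rewrite !RLmin_cons IH // addnA; congr (nat_of_bool _ + _ + _)%N.
by rewrite !all_cat /= xa.
Qed.

(** Positivity ensures that the truncated exponents [LRmin - 1] and [RLmin - 1] really grow by 1 at
    an end insertion. *)
Lemma LRmin_gt0 x w : (0 < LRmin (x :: w))%N.
Proof. by []. Qed.

Lemma RLmin_gt0 x w : (0 < RLmin (x :: w))%N.
Proof. by elim: w x => // y w IH x; rewrite RLmin_cons ltn_addl. Qed.

Lemma peaks_cons x y z w :
  peaks [:: x, y, z & w] = ((x < y) && (z < y) + peaks [:: y, z & w])%N.
Proof.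
rewrite /peaks /= !subSS !subn0 /=; congr (_ + _)%N.
rewrite (iotaDl 1 1) count_map; apply: eq_in_count => i.
by rewrite mem_iota => /andP[]; case: i.
Qed.

Lemma peaks_descent x y w : (y < x)%N -> peaks [:: x, y & w] = peaks (y :: w).
Proof.
by case: w => // z w yx; rewrite peaks_cons ltnNge ltnW.
Qed.

Lemma peaks_top x a y w : (x < a)%N -> (y < a)%N ->
  peaks [:: x, a, y & w] = (peaks (y :: w)).+1.
Proof. by move=> xa ya; rewrite peaks_cons xa ya peaks_descent. Qed.

Lemma peaks_rcons_max a x w : all (gtn a) (x :: w) ->
  peaks (rcons (x :: w) a) = peaks (x :: w).
Proof.
elim: w x => // y [|z w] IH x /andP[xa lt_w].
  case/andP: lt_w => /= ya _; rewrite peaks_cons.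
  by rewrite [(a < y)%N]ltnNge (ltnW ya) andbF.
by rewrite !rcons_cons !peaks_cons -!rcons_cons IH.
Qed.

(** Peaks are interior and never adjacent: when the second letter is a peak, the induction skips two
    letters. The bound makes the subtractions of twice the peak number exact. *)
Lemma peaks_bound x w : ((peaks (x :: w)).*2 <= size w)%N.
Proof.
have [k] := ubnP (size w); elim: k => // k IH in x w *.
case: w => [|y [|z w]] //=; rewrite !ltnS peaks_cons => le_wk.
case: (boolP (_ && _)) => [/andP[_ zy]|_].
  by rewrite peaks_descent // doubleD; apply: IH; apply: leq_trans le_wk.
by rewrite add0n ltnW // ltnS; apply: IH.
Qed.

(* Among the inner gaps, the two adjacent to a given peak preserve the number of
   peaks, and all others raise it. *)
Lemma sum_peaks_insert (V : pzRingType) (phi : nat -> V) a x w :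
  all (gtn a) (x :: w) ->
  \sum_(i < size w) phi (peaks (x :: insert i a w)) =
    phi (peaks (x :: w)) *+ (peaks (x :: w)).*2 +
    phi (peaks (x :: w)).+1 *+ (size w - (peaks (x :: w)).*2).
Proof.
elim: w x phi => [|y w IH] x phi; first by rewrite big_ord0 addr0.
case: w IH => [_|z w IH] /and3P[/= xa ya lt_w].
  by rewrite big_ord1 /insert /= peaks_top // add0r mulr1n.
rewrite big_ord_recl /insert /= peaks_top //.
case/andP: (lt_w) => /= za _.
pose b : nat := ((x < y) && (z < y))%N.
(* Shifting [phi] by [b] accounts for a peak at [y]. Only the gap between [y] and [z] is then
   misjudged, since [a] placed there destroys that peak. *)
have := IH y (fun k => phi (b + k)%N); rewrite /= ya => /(_ lt_w).
rewrite !big_ord_recl /= /insert /= (peaks_top y a z) //.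
rewrite (peaks_cons x y z) -/b (peaks_cons x y a) (peaks_top y a z) //.
rewrite [(a < y)%N]ltnNge (ltnW ya) andbF add0n.
set A := \sum_(i < size w) _; set B := \sum_(i < size w) _.
have -> : B = A by apply: eq_bigr => i _; rewrite peaks_cons.
have := peaks_bound y (z :: w); have := peaks_bound z w.
(* If [y] is a peak, the wrong term is moved across and both gaps around [y] keep the count;
   otherwise the hypothesis is exact and the first gap adds one peak. *)
rewrite /b; case: (boolP (_ && _)) => [/andP[_ zy]|_].
  rewrite peaks_descent //=; set p := peaks _ => le1 le2 /(canRL (addKr _)) ->.
  have -> : ((size w).+1 - p.*2 = (size w - p.*2).+1)%N by lia.
  rewrite !add1n doubleS !subSS.
  by rewrite (mulrS _ (_ - _)) !(mulrS _ p.*2.+1) (mulrS _ p.*2) [_ *+ _ + _]addrCA addKr !addrA.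
rewrite /= !add0n => le1 le2 ->.
by rewrite addrCA -mulrS -subSn.
Qed.

(** * Permutations as insertions of a maximum *)

Lemma pword_lift_perm m (i : 'I_m.+1) (t : 'S_m) :
  pword (lift_perm i ord_max t) = insert i m (pword t).
Proof.
have szw : size (pword t) = m by rewrite size_map size_enum_ord.
have le_im : (i <= m)%N by rewrite -ltnS.
apply: (@eq_from_nth _ 0%N).
  rewrite size_map size_enum_ord size_cat /= size_drop szw size_takel ?szw //; lia.
rewrite size_map size_enum_ord => j lt_j.
rewrite (nth_map i) ?size_enum_ord // (_ : nth i _ j = Ordinal lt_j); last first.
  by apply: val_inj; rewrite /= nth_enum_ord.
rewrite nth_cat size_takel ?szw //.
case: (unliftP i (Ordinal lt_j)) => [k|] ej; last first.
  by rewrite ej lift_perm_id -ej /= ltnn subnn.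
(* Lifting around the maximum leaves the values of [t] unchanged; only positions shift. *)
rewrite ej lift_perm_lift. rewrite [\val _]lift_max.
have nthk : nth 0%N (pword t) k = t k.
  rewrite (nth_map k) ?size_enum_ord //; congr (val (t _)).
  by apply: val_inj; rewrite /= nth_enum_ord.
move/(congr1 val): ej => /= ->; rewrite /bump.
case: (leqP i k) => [le_ik|lt_ki]; last by rewrite add0n lt_ki nth_take.
rewrite add1n ltnNge (leqW le_ik) /= subSn //= nth_drop subnKC //.
Qed.

(** The position of the maximum recovers the gap, and the other letters recover [t]; injectivity and
    the count (m+1) m! = (m+1)! give a bijection. *)
Lemma sum_perm_insert_max (V : nmodType) m (F : seq nat -> V) :
  \sum_(s : 'S_m.+1) F (pword s) =
  \sum_(t : 'S_m) \sum_(i < m.+1) F (insert i m (pword t)).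
Proof.
pose L (p : 'S_m * 'I_m.+1) := lift_perm p.2 ord_max p.1.
have L_inj : injective L.
  move=> [t i] [t' i'] /= eqL.
  have eq_i : i = i'.
    apply: (@perm_inj _ (L (t', i'))).
    by rewrite -{1}eqL /L /= !lift_perm_id.
  rewrite -eq_i in eqL *; congr (_, _); apply/permP => k.
  have /permP/(_ (lift i k)) := eqL.
  by rewrite !lift_perm_lift => /lift_inj.
have L_bij : bijective L.
  apply: inj_card_bij => //.
  by rewrite card_prod !card_Sn card_ord factS mulnC.
rewrite (reindex L) /=; last exact: onW_bij.
rewrite pair_bigA /=; apply: eq_bigr => -[t i] _.
by rewrite pword_lift_perm.
Qed.

Lemma pword_lt m (t : 'S_m) : all (gtn m) (pword t).
Proof. by rewrite all_map; apply/allP => i _ /=. Qed.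

Lemma size_pword m (t : 'S_m) : size (pword t) = m.
Proof. by rewrite size_map size_enum_ord. Qed.

(** * The series of the theorem *)

Section PeakSeries.
Variables (R : fieldType) (v s : R).
Hypotheses (char0 : [pchar R] =i pred0) (s0 : s != 0).

Let den : fps R := fps_const s * fps_cosh s - fps_const v * fps_sinh s.
Let F := rhs_base v s.
Let Y := fps_deriv (fps_log F).

Let coef0_den : coef 0 den = s.
Proof.
by rewrite raddfB /= !coef_constM !coefE /fps_cosh /fps_sinh /= invr1 !mulr1 mulr0 subr0.
Qed.

Let F_den : F * den = fps_const s.
Proof.
rewrite /F /rhs_base !fps_scaleE -/den mulrAC -mulrA.
by rewrite fps_mulV ?mulr1 // -coefE coef0_den.
Qed.

Let F0 : F 0%N = 1.
Proof.
apply: (mulIf s0); rewrite mul1r -[F 0%N]coefE -{1}coef0_den -rmorphM F_den.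
exact: coef_const.
Qed.

(* With [den] the denominator, [Y = - den' / den] and [den'' = s ^ 2 den]. *)
Let Y_den : Y * den = - fps_deriv den.
Proof.
have /(congr1 (fps_deriv)) := F_den; rewrite fps_derivM fps_deriv_const.
rewrite -(fps_log_deriv _ char0 F F0) -/Y => eq0.
(* The factor [den] turns [F] into the constant [s], which can be inverted. *)
have : den * (Y * F * den + F * fps_deriv den) = 0 by rewrite eq0 mulr0.
rewrite (_ : den * _ = fps_const s * (Y * den + fps_deriv den)); last first.
  by rewrite -F_den; ring.
move/(congr1 ( *%R (fps_const s^-1))); rewrite mulr0 mulrA -rmorphM mulVf //.
by rewrite rmorph1 mul1r => /eqP; rewrite addr_eq0 => /eqP.
Qed.

Lemma coef0_log_deriv_rhs_base : coef 0 Y = v.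
Proof.
have /(congr1 (coef 0)) := Y_den; rewrite coefN coefM big_ord1 coef0_den.
rewrite /den (raddfB fps_deriv) /= !fps_derivM !fps_deriv_const !mul0r !add0r.
rewrite fps_deriv_cosh // fps_deriv_sinh // coefB !coef_constM.
rewrite !coefE /fps_cosh /fps_sinh /= invr1 !mulr1 !mulr0 sub0r opprK.
exact: mulIf.
Qed.

(** Differentiating Y den = -den' and using den'' = s^2 den gives the equation times [den];
    multiplying by [F] replaces [den] by the invertible constant [s]. *)
Lemma riccati_rhs_base : fps_deriv Y = Y ^+ 2 - fps_const (s ^+ 2).
Proof.
have den2 : fps_deriv (fps_deriv den) = fps_const (s ^+ 2) * den.
  rewrite /den !(raddfB (fps_deriv)) /= !fps_derivM !fps_deriv_const !mul0r !add0r.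
  rewrite fps_deriv_cosh // fps_deriv_sinh // !fps_derivM !fps_deriv_const.
  by rewrite fps_deriv_cosh // fps_deriv_sinh // rmorphXn; ring.
have /(congr1 (fps_deriv)) := Y_den.
rewrite raddfN /= fps_derivM den2 => eqY.
have dY : fps_deriv den = - (Y * den) by rewrite Y_den opprK.
have : F * ((fps_deriv Y - (Y ^+ 2 - fps_const (s ^+ 2))) * den) = 0.
  transitivity (F * (fps_deriv Y * den + Y * fps_deriv den + fps_const (s ^+ 2) * den)).
    by rewrite dY; ring.
  by rewrite eqY addNr mulr0.
rewrite mulrCA F_den => /(congr1 ( *%R^~ (fps_const s^-1))).
rewrite mul0r -mulrA -rmorphM divff // rmorph1 mulr1.
by move/eqP; rewrite subr_eq0 => /eqP.
Qed.

Lemma deriv_powc_rhs_base c :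
  fps_deriv (fps_powc F c) = fps_const c * Y * fps_powc F c.
Proof. exact: fps_deriv_powc. Qed.

End PeakSeries.

(** * Insertion as differentiation *)

Section InsertionGrammar.
Variables (R : fieldType) (c1 c2 : R) (E Y W : fps R).
Hypotheses (dE : fps_deriv E = fps_const (c1 + c2) * Y * E)
  (dY : fps_deriv Y = W) (dW : fps_deriv W = Y * W *+ 2).

(** The weight of a word of length [n.+1], with [W] for u^2 and [Y] for v. *)
Let term n (w : seq nat) : fps R :=
  fps_const (c1 ^+ (LRmin w - 1) * c2 ^+ (RLmin w - 1))
  * (W ^+ peaks w * Y ^+ (n - (peaks w).*2)).

(* Chen--Fu grammar: [W] and [Y] evolve as [u ^ 2] and [v] do under [u -> u v],
   [v -> u ^ 2], which is the effect of inserting a new maximum in an inner gap;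
   the factor [(c1 + c2) Y] accounts for the two end gaps. *)
Lemma deriv_term n x w : size w = n -> all (gtn n.+1) (x :: w) ->
  fps_deriv (E * term n (x :: w)) =
  E * \sum_(i < n.+2) term n.+1 (insert i n.+1 (x :: w)).
Proof.
move=> szw lt_w; rewrite fps_derivM dE -[fps_const _ * Y * E]mulrC -mulrA -mulrDr.
congr (_ * _); pose G i := term n.+1 (insert i n.+1 (x :: w)).
(* The two end gaps are separated from the [n] inner ones. *)
have -> : \sum_(i < n.+2) G i = G 0%N + (\sum_(i < n) G i.+1 + G n.+1).
  by rewrite big_ord_recl big_ord_recr.
set K := c1 ^+ (LRmin (x :: w) - 1) * c2 ^+ (RLmin (x :: w) - 1).
pose phi k := fps_const K * (W ^+ k * Y ^+ (n.+1 - k.*2)).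
have lt_x : (x < n.+1)%N by case/andP: lt_w.
have L0 := LRmin_gt0 x w; have R0 := RLmin_gt0 x w.
set M := peaks (x :: w).
have leM : (M.*2 <= n)%N by rewrite -szw peaks_bound.
have -> : G 0%N = fps_const c1 * phi M.
  rewrite /G /term LRmin_insert // RLmin_insert // addn0 addn1 subn1 /=.
  rewrite /insert /= peaks_descent // -/M /phi [RHS]mulrA -rmorphM; congr (fps_const _ * _).
  by rewrite /K !subn1 mulrA -exprS prednK.
have -> : G n.+1 = fps_const c2 * phi M.
  have szxw : size (x :: w) = n.+1 by rewrite /= szw.
  rewrite /G /term LRmin_insert ?RLmin_insert ?szxw // eqxx addn0 addn1.
  rewrite (_ : insert _ _ _ = rcons (x :: w) n.+1); last first.
    by rewrite /insert take_oversize ?drop_oversize ?cats1 ?szxw.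
  rewrite peaks_rcons_max // -/M /phi [RHS]mulrA -rmorphM; congr (fps_const _ * _).
  by rewrite /K !subn1 mulrCA -exprS prednK.
have -> : \sum_(i < n) G i.+1 =
    phi M *+ M.*2 + phi M.+1 *+ (n - M.*2).
  have := sum_peaks_insert _ phi n.+1 x w lt_w; rewrite szw => <-.
  apply: eq_bigr => i _.
  rewrite /G /term LRmin_insert ?RLmin_insert //= ?szw ?ltnS ?[(i <= _)%N]ltnW //.
  by rewrite eqSS (ltn_eqF (ltn_ord i)) !addn0.
have -> : phi M = fps_const K * (W ^+ M * Y ^+ (n - M.*2)) * Y.
  by rewrite /phi subSn // exprSr !mulrA.
(* The truncated predecessor is also the exponent produced by differentiating the power of [Y]; when
   n = 2M both sides carry the factor 0. *)
have -> : phi M.+1 = fps_const K * (W ^+ M.+1 * Y ^+ (n - M.*2).-1).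
  by rewrite /phi doubleS subSS subnS.
rewrite /term -/M -/K !fps_derivM fps_deriv_const mul0r add0r !fps_derivXn dW dY.
(* The derivative of W^M is 2M Y W^M, matching the 2M gaps beside a peak; the derivative of the
   power of [Y] matches the other inner gaps. *)
have -> : Y * W *+ 2 * W ^+ M.-1 *+ M = W ^+ M * Y *+ M.*2.
  by case: (M) => [|k]; rewrite ?mulr0n // exprS -mul2n mulrnA; ring.
rewrite rmorphD exprS; ring.
Qed.

Lemma iter_deriv n : iter n fps_deriv E = E * \sum_(t : 'S_n.+1) term n (pword t).
Proof.
elim: n => [|n IH].
  rewrite big_mkcond /= (bigD1 1%g) //= big1 => [|t /negP[]]; last first.
    by apply/eqP/permP => i; rewrite !ord1.
  rewrite addr0 (_ : pword _ = [:: 0%N]); last first.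
    by rewrite /pword enum_ordSl /= perm1 (size0nil (s := enum 'I_0)) // size_enum_ord.
  by rewrite /term /= !expr0 !mulr1 rmorph1 mulr1.
rewrite iterS IH (sum_perm_insert_max _ n.+1) mulr_sumr raddf_sum mulr_sumr.
apply: eq_bigr => t _ /=.
have szt := size_pword _ t; have lt_t := pword_lt _ t.
case: (pword t) szt lt_t => // x w [szw] lt_w.
exact: deriv_term.
Qed.

End InsertionGrammar.

(** * Comparison of constant terms *)

Theorem theorem4p5 (R : fieldType) (HR : [pchar R] =i pred0)
  (u v alpha beta s : R) (Hs : s ^+ 2 = v ^+ 2 - u ^+ 2) (Hs0 : s != 0)
  (n : nat) :
  (\sum_(sigma : 'S_n.+1)
      u ^+ (2 * peaks (pword sigma)) * v ^+ (n - 2 * peaks (pword sigma))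
      * alpha ^+ (LRmin (pword sigma) - 1) * beta ^+ (RLmin (pword sigma) - 1))
    / (n`!)%:R
  = fps_powc (rhs_base v s) (alpha + beta) n.
Proof.
pose Y := fps_deriv (fps_log (rhs_base v s)).
pose W := fps_deriv Y.
have eqW : W = Y ^+ 2 - fps_const (s ^+ 2) by apply: riccati_rhs_base.
have dW : fps_deriv W = Y * W *+ 2.
  by rewrite {1}eqW raddfB /= fps_deriv_const subr0 fps_derivXn expr1 mulrC.
have Y0 : coef 0 Y = v by apply: coef0_log_deriv_rhs_base.
(* The relation s^2 = v^2 - u^2 enters here: W(0) = v^2 - s^2. *)
have W0 : coef 0 W = u ^+ 2.
  by rewrite eqW coefB rmorphXn /= Y0 coef_const mulr1n Hs opprB addrC subrK.
have fact_neq0 : n`!%:R != 0 :> R.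
  by move/pcharf0P: HR => ->; rewrite -lt0n fact_gt0.
apply: (mulIf fact_neq0); rewrite divfK // mulr_natr -[fps_powc _ _ n]coefE.
have dE := deriv_powc_rhs_base R v s HR Hs0 (alpha + beta).
rewrite -coef0_iter_deriv (iter_deriv _ _ _ _ _ _ dE (erefl _) dW).
(* The power of the base has constant term 1, so taking constant terms leaves the weights with u^2
   and v restored. *)
rewrite coefM big_ord1 coefE coef0_powc mul1r coef_sum; apply: eq_bigr => t _.
rewrite coef_constM rmorphM !rmorphXn /= W0 Y0 -exprM -mul2n; ring.
Qed.
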